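(* Let $\eta,\lambda>0$ with $\eta\lambda\le\tfrac12$, let $x(0)$ satisfy $\|x(0)\|_2^2\ge\pi^2\rho\eta$, and $x(t+1)=(1-\eta\lambda)x(t)-\eta\nabla L(x(t))$. Let $T_0=\left\lceil\frac{1}{2\eta\lambda}\ln\frac{2\|x(0)\|_2^2}{\rho\pi^2\eta}\right\rceil$. Then $$\min_{t=0,\ldots,T_0}\|\nabla L(\bar x(t))\|_2^2\le 8\pi^4\rho^2\lambda\eta .$$
   Context: $L:\mathbb{R}^d\setminus\{0\}\to\mathbb{R}$ is $C^2$ and scale invariant, i.e. $L(cx)=L(x)$ for all $c>0$, $x\ne0$. $\rho:=\max_{\|x\|_2=1}\|\nabla^2L(x)\|_2>0$ (spectral norm). For $x\neq0$, $\bar x:=x/\|x\|_2$. *)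

(* Defs.v *)
From HB Require Import structures.
From mathcomp Require Import all_boot all_order all_algebra.
From mathcomp Require Import all_classical all_reals all_analysis.
Set Implicit Arguments. Unset Strict Implicit. Unset Printing Implicit Defensive.
Import Order.TTheory GRing.Theory Num.Theory.
Import numFieldNormedType.Exports.
Local Open Scope classical_set_scope.
Local Open Scope ring_scope.

(* Euclidean (l2) norm on R^d (the library norm on 'rV is the max norm). *)
Definition norm2 {R : realType} {d : nat} (v : 'rV[R]_d) : R :=
  Num.sqrt (\sum_(i < d) v 0 i ^+ 2).

Definition evec {R : realType} {d : nat} (i : 'I_d) : 'rV[R]_d := delta_mx 0 i.

Definition grad {R : realType} {d : nat} (L : 'rV[R]_d -> R) (x : 'rV[R]_d)
  : 'rV[R]_d := \row_(i < d) ('D_(evec i) L x).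

(* Hessian: row i is the partial derivative of the gradient along e_i,
   so that v *m hess L x = (D_v grad L)(x) = (Hessian) v. *)
Definition hess {R : realType} {d : nat} (L : 'rV[R]_d -> R) (x : 'rV[R]_d)
  : 'M[R]_d := \matrix_(i < d, j < d) ('D_(evec i) (fun y => grad L y 0 j) x).

Definition specnorm {R : realType} {d : nat} (A : 'M[R]_d) : R :=
  sup [set norm2 (v *m A) | v in [set v : 'rV[R]_d | norm2 v = 1]].

Definition C2_off0 {R : realType} {d : nat} (L : 'rV[R]_d -> R) : Prop :=
  (forall x : 'rV[R]_d, x != 0 -> differentiable L x) /\
  (forall x : 'rV[R]_d, x != 0 -> differentiable (grad L) x) /\
  (forall x : 'rV[R]_d, x != 0 -> {for x, continuous (hess L)}).

Definition scale_invariant {R : realType} {d : nat} (L : 'rV[R]_d -> R) : Prop :=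
  forall (c : R) (x : 'rV[R]_d), 0 < c -> x != 0 -> L (c *: x) = L x.

Definition is_rho {R : realType} {d : nat} (L : 'rV[R]_d -> R) (rho : R) : Prop :=
  (exists2 u : 'rV[R]_d, norm2 u = 1 & specnorm (hess L u) = rho) /\
  (forall u : 'rV[R]_d, norm2 u = 1 -> specnorm (hess L u) <= rho).

Definition normalize {R : realType} {d : nat} (x : 'rV[R]_d) : 'rV[R]_d :=
  (norm2 x)^-1 *: x.

(* Main.v *)
Require Import Defs.
From HB Require Import structures.
From mathcomp Require Import all_boot all_order all_algebra.
From mathcomp Require Import all_classical all_reals all_analysis.
From mathcomp Require Import ring lra.
Import Order.TTheory GRing.Theory Num.Theory.
Import numFieldNormedType.Exports.
Local Open Scope ring_scope.

(* Write [y t] for the squared norm of the iterate [x t], [g t] for the gradient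
   there, and [M = pi^2 rho eta]; suppose the gradient on the sphere stays large
   for all [t <= T0].  Since [g t] is orthogonal to [x t],
   [y t.+1 = (1 - eta lambda)^2 y t + eta^2 |g t|^2], and a large gradient forces
   [M < y t.+1] as soon as [M <= y t].  While [M <= y t], the segment from [x t]
   along [- g t] stays outside the ball of radius [sqrt (y t)], where the Hessian
   is at most [rho / y t], so [L] decreases by at least [eta |g t|^2 / 2].
   Restricted to a great circle, [L] is [2 pi]-periodic with second derivative
   bounded by [rho], hence its oscillation is at most [rho pi^2 / 4].  Summing,
   [y T0 <= (1 - eta lambda)^(2 T0) y 0 + 2 eta rho pi^2 / 4 <= M / 2 + M / 2],
   contradicting [M < y T0]. *)

(** * Euclidean inner product; quadratic forms bounded by the spectral norm *)

Definition dot {R : realType} {d : nat} (u v : 'rV[R]_d) : R :=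
  \sum_(i < d) u 0 i * v 0 i.

Section Euclidean.
Context {R : realType} {d : nat}.
Implicit Types (u v w : 'rV[R]_d) (A : 'M[R]_d).

Lemma dotC u v : dot u v = dot v u.
Proof. by apply: eq_bigr => i _; rewrite mulrC. Qed.

Lemma dotDl u v w : dot (u + v) w = dot u w + dot v w.
Proof. by rewrite -big_split; apply: eq_bigr => i _; rewrite mxE mulrDl. Qed.

Lemma dotZl a u v : dot (a *: u) v = a * dot u v.
Proof. by rewrite /dot mulr_sumr; apply: eq_bigr => i _; rewrite mxE mulrA. Qed.

Lemma dotDr u v w : dot u (v + w) = dot u v + dot u w.
Proof. by rewrite dotC dotDl !(dotC _ u). Qed.

Lemma dotZr a u v : dot u (a *: v) = a * dot u v.
Proof. by rewrite dotC dotZl dotC. Qed.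

Lemma dotNl u v : dot (- u) v = - dot u v.
Proof. by rewrite -scaleN1r dotZl mulN1r. Qed.

Lemma dotNr u v : dot u (- v) = - dot u v.
Proof. by rewrite dotC dotNl dotC. Qed.

Lemma dot0r u : dot u 0 = 0.
Proof. by rewrite /dot big1 // => i _; rewrite mxE mulr0. Qed.

Lemma dot_ge0 u : 0 <= dot u u.
Proof. by apply: sumr_ge0 => i _; rewrite -expr2 sqr_ge0. Qed.

Lemma dot_eq0 u : (dot u u == 0) = (u == 0).
Proof.
rewrite psumr_eq0; last by move=> i _; rewrite -expr2 sqr_ge0.
apply/allP/eqP => [u0|-> i _]; last by rewrite /= !mxE mul0r eqxx.
apply/rowP => i; rewrite mxE; apply/eqP.
by have := u0 i (mem_index_enum _); rewrite /= mulf_eq0 orbb.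
Qed.

Lemma dot_gt0 u : u != 0 -> 0 < dot u u.
Proof. by move=> u0; rewrite lt_neqAle dot_ge0 eq_sym dot_eq0 u0. Qed.

Lemma norm2E u : norm2 u = Num.sqrt (dot u u).
Proof. by congr Num.sqrt; apply: eq_bigr => i _; rewrite expr2. Qed.

Lemma norm2_sqr u : norm2 u ^+ 2 = dot u u.
Proof. by rewrite norm2E sqr_sqrtr ?dot_ge0. Qed.

Lemma norm2_gt0 u : u != 0 -> 0 < norm2 u.
Proof. by move=> u0; rewrite norm2E sqrtr_gt0 dot_gt0. Qed.

Lemma dot_normalize u : u != 0 -> dot (normalize u) (normalize u) = 1.
Proof.
move=> u0; rewrite dotZl dotZr -norm2_sqr.
by have := norm2_gt0 u u0 => n0; field; apply: lt0r_neq0.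
Qed.

(* Without an upper bound the supremum in [specnorm] would be a junk value. *)
Lemma norm2_mulmx_le A v : norm2 v = 1 -> norm2 (v *m A) <= specnorm A.
Proof.
move=> v1; apply: ub_le_sup; last by exists v.
exists (Num.sqrt (\sum_j (\sum_i `|A i j|) ^+ 2)) => _ [w w1 <-].
rewrite /norm2 ler_wsqrtr //; apply: ler_sum => j _.
rewrite -real_normK ?num_real // lerXn2r ?nnegrE ?sumr_ge0 //.
rewrite mxE (le_trans (ler_norm_sum _ _ _)) //; apply: ler_sum => i _.
rewrite normrM ler_piMl //.
suff : w 0 i ^+ 2 <= 1 by rewrite -real_normK ?num_real // expr_le1.
have <- : dot w w = 1 by rewrite -norm2_sqr w1 expr1n.
rewrite /dot (bigD1 i) //= -expr2 lerDl sumr_ge0 // => k _.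
by rewrite -expr2 sqr_ge0.
Qed.

(** After scaling to a unit [u], expand the squared norms of [u *m A + rho *: u] and
    [u *m A - rho *: u], both nonnegative, and use [norm2 (u *m A) <= rho]. *)
Lemma quadratic_form_le A v rho : 0 < rho -> specnorm A <= rho ->
  `|dot (v *m A) v| <= rho * dot v v.
Proof.
move=> rho0 Arho; have [->|v0] := eqVneq v 0.
  by rewrite !dot0r normr0 mulr0.
have [u [u1 vE]] : exists u, dot u u = 1 /\ v = norm2 v *: u.
  exists (normalize v); split; first exact: dot_normalize.
  by rewrite scalerA divff ?scale1r // lt0r_neq0 ?norm2_gt0.
have nu : norm2 u = 1 by rewrite norm2E u1 sqrtr1.
have nA : dot (u *m A) (u *m A) <= rho ^+ 2.
  rewrite -norm2_sqr lerXn2r ?nnegrE ?sqrtr_ge0 ?(ltW rho0) //.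
  exact: le_trans (norm2_mulmx_le A u nu) Arho.
have H : `|dot (u *m A) u| <= rho.
  have := dot_ge0 (u *m A + rho *: u); have := dot_ge0 (u *m A - rho *: u).
  rewrite !(dotDl, dotDr, dotNl, dotNr, dotZl, dotZr) u1 (dotC u).
  rewrite ler_norml; nra.
rewrite {}vE; move: (norm2 v) (sqrtr_ge0 _ : 0 <= norm2 v) => n n0.
rewrite -scalemxAl !(dotZl, dotZr) u1 !normrM !mulr1 ger0_norm //.
nra.
Qed.

End Euclidean.

(** * Second-order Taylor bound; oscillation of periodic functions of one variable *)

Section Taylor.
Context {R : realType}.

(** The order of [a] and [b] is left free; the sign condition keeps [c] on the same side of [a] as
    [b]. *)
Lemma is_derive_MVT (f f' : R -> R) (a b : R) :
  (forall t : R, is_derive t 1 f (f' t)) ->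
  exists2 c, 0 <= (c - a) * (b - a) & f b - f a = f' c * (b - a).
Proof.
move=> df.
have cf s t : ({within `[s, t], continuous f})%classic.
  by apply: derivable_within_continuous => x _; exact: ex_derive.
case: (leP a b) => ab.
  have [c /[!in_itv] /= /andP[ac cb] E] := MVT_segment ab (fun t _ => df t) (cf _ _).
  by exists c => //; apply: mulr_ge0; lra.
have [c /[!in_itv] /= /andP[bc ca] E] :=
  MVT_segment (ltW ab) (fun t _ => df t) (cf _ _).
exists c; first by apply: mulr_le0; lra.
by rewrite -[b - a]opprB mulrN -E opprB.
Qed.

Lemma taylor2_le (f f' f'' : R -> R) (K a b : R) :
  (forall t : R, is_derive t 1 f (f' t)) -> (forall t : R, is_derive t 1 f' (f'' t)) ->
  (forall t, f'' t <= K) ->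
  f b <= f a + f' a * (b - a) + K / 2 * (b - a) ^+ 2.
Proof.
move=> df df' f''K.
(* Up to the constant [f a], [h] is the quadratic majorant minus [f]. The mean value theorem for
   [h], then for [f'], writes its increment as [K - f'' e] times a nonnegative factor. *)
pose h t := K / 2 * (t - a) ^+ 2 + f' a * (t - a) - f t.
pose h' t := K * (t - a) + f' a - f' t.
have dh (t : R) : is_derive t 1 h (h' t).
  rewrite /h /h'; apply: is_derive_eq; rewrite /GRing.scale/=; by field.
have [c ca hE] := is_derive_MVT h h' a b dh.
have [e ea h'E] := is_derive_MVT f' f'' a c df'.
suff : 0 <= h' c * (b - a).
  rewrite -hE /h subrr expr0n /=; lra.
have -> : h' c = (K - f'' e) * (c - a) by rewrite mulrBl -h'E /h'; lra.
by rewrite -mulrA mulr_ge0 // subr_ge0.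
Qed.

(* The constant comes from applying Taylor's formula at a maximiser and at a
   minimiser of [f], at most half a period apart, up to their midpoint. *)
Lemma periodic_oscillation_le (f f' f'' : R -> R) (K p a b : R) : 0 < p ->
  (forall t : R, is_derive t 1 f (f' t)) -> (forall t : R, is_derive t 1 f' (f'' t)) ->
  (forall t, `|f'' t| <= K) ->
  (forall t, f (t + p) = f t) -> (forall t, f' (t + p) = f' t) ->
  0 <= a <= p -> 0 <= b <= p ->
  f a - f b <= K * p ^+ 2 / 16.
Proof.
move=> p0 df df' f''K fp f'p abnd bbnd.
have cf : ({within `[0, p], continuous f})%classic.
  by apply: derivable_within_continuous => x _; exact: ex_derive.
have [s s0p smax] := EVT_max (ltW p0) cf.
have [r r0p rmin] := EVT_min (ltW p0) cf.
(* An extremum over [[0, p]] may sit at an endpoint; by periodicity it is also one over [(-p, 2p)],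
   where it is interior, so [f'] vanishes there. *)
have window (P : R -> Prop) : (forall t, t \in `[0, p] -> P (f t)) ->
    forall t, t \in `](- p), (2 * p)[ -> P (f t).
  move=> P0p t /[!in_itv] /= /andP[tl tr].
  case: (ltP t 0) => t0; first by rewrite -fp; apply: P0p; rewrite in_itv /=; lra.
  case: (leP t p) => tp; first by apply: P0p; rewrite in_itv /=; lra.
  by rewrite -(subrK p t) fp; apply: P0p; rewrite in_itv /=; lra.
have inner t : t \in `[0, p] -> t \in `](- p), (2 * p)[.
  by rewrite !in_itv /= => /andP[? ?]; apply/andP; split; lra.
have dff t : t \in `](- p), (2 * p)[ -> derivable f t 1 by move=> _; exact: ex_derive.
have pp : - p <= 2 * p by lra.
have f's : f' s = 0.
  have := derive1_at_max pp dff (inner s s0p) (window (fun y => y <= f s) smax).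
  by move=> /@derive_val <-; rewrite derive_val.
have f'r : f' r = 0.
  have := derive1_at_min pp dff (inner r r0p) (window (fun y => f r <= y) rmin).
  by move=> /@derive_val <-; rewrite derive_val.
(* If [s] and [r] are more than half a period apart, shifting [r] by one period brings them close
   enough. *)
have [r' [f'r' fr' sr']] : exists r', [/\ f' r' = 0, f r' = f r & `|s - r'| <= p / 2].
  move: s0p r0p; rewrite !in_itv /= => s0p r0p.
  case: (ltP (p / 2) (s - r)) => sr.
    by exists (r + p); rewrite f'p fp; split=> //; rewrite ler_norml; lra.
  case: (ltP (s - r) (- (p / 2))) => sr2.
    exists (r - p); rewrite -(f'p (r - p)) -(fp (r - p)) subrK; split=> //.
    by rewrite ler_norml; lra.
  by exists r; split=> //; rewrite ler_norml; lra.
pose m := (s + r') / 2.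
have up : f m <= f r' + K / 2 * (m - r') ^+ 2.
  have := @taylor2_le f f' f'' K r' m df df'.
  rewrite f'r' mul0r addr0; apply => t.
  by have := f''K t; rewrite ler_norml => /andP[].
have down : f s <= f m + K / 2 * (m - s) ^+ 2.
  have := @taylor2_le (fun t => - f t) (fun t => - f' t) (fun t => - f'' t) K s m.
  rewrite f's oppr0 mul0r addr0 => H.
  suff : - f m <= - f s + K / 2 * (m - s) ^+ 2 by lra.
  apply: H => t; have := f''K t; rewrite ler_norml => /andP[]; lra.
have fa : f a <= f s by apply: smax; rewrite in_itv.
have fb : f r <= f b by apply: rmin; rewrite in_itv.
have K0 : 0 <= K by exact: le_trans (f''K 0).
have srp : (s - r') ^+ 2 <= (p / 2) ^+ 2.
  by rewrite -real_normK ?num_real // lerXn2r ?nnegrE //; lra.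
(* Each Taylor step has length at most [p / 4], so each of the two costs at most
   [K * p ^+ 2 / 32]. *)
have -> : K * p ^+ 2 / 16 = K / 4 * (p / 2) ^+ 2 by field.
have : K / 4 * (s - r') ^+ 2 <= K / 4 * (p / 2) ^+ 2 by apply: ler_wpM2l; lra.
have -> : K / 4 * (s - r') ^+ 2 = K / 2 * (m - r') ^+ 2 + K / 2 * (m - s) ^+ 2.
  by rewrite /m; field.
by lra.
Qed.

End Taylor.

(** * Chain rule along curves and derivatives of homogeneous functions *)

Section Calculus.
Context {R : realType} {d : nat}.
Implicit Types (u v x y p q : 'rV[R]_d) (F L : 'rV[R]_d -> R).

Lemma derive_dot_grad F x v : differentiable F x -> 'D_v F x = dot (grad F x) v.
Proof.
move=> dF; rewrite deriveE // [in LHS](row_sum_delta v) linear_sum.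
by apply: eq_bigr => i _; rewrite linearZ /= !mxE deriveE // mulrC.
Qed.

Lemma is_derive_curve F (c : R -> 'rV[R]_d) (t : R) (v : 'rV[R]_d) :
  differentiable F (c t) -> is_derive t 1 c v ->
  is_derive t 1 (fun s => F (c s)) (dot (grad F (c t)) v).
Proof.
move=> dF [dc cv].
have dct : differentiable c t by apply/derivable1_diffP.
have dFc : differentiable (F \o c) t by exact: differentiable_comp.
apply: DeriveDef; first exact/derivable1_diffP.
by rewrite -derive_dot_grad // -cv deriveE // diff_comp // !deriveE.
Qed.

(** Covers the three kinds of curve used below: rays, straight lines and great circles. *)
Lemma is_derive_combination (a b : R -> R) (t a' b' : R) p q :
  is_derive t 1 a a' -> is_derive t 1 b b' ->
  is_derive t 1 (fun s => a s *: p + b s *: q) (a' *: p + b' *: q).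
Proof.
move=> [da a'E] [db b'E].
have dZ (f : R -> R) (r : 'rV[R]_d) : derivable f t 1 ->
    is_derive t 1 (fun s => f s *: r) ('D_1 f t *: r).
  move=> /derivable1_diffP df.
  have dfr : differentiable (fun s => f s *: r) t by exact: differentiableZl.
  apply: DeriveDef; first exact/derivable1_diffP.
  by rewrite !deriveE // diffZl.
rewrite -a'E -b'E; exact: (is_deriveD (dZ a p da) (dZ b q db)).
Qed.

Lemma near_neq0 x : x != 0 -> \forall y \near x, y != 0.
Proof.
move=> x0; apply/nbhs_ballP; exists `|x|; first by rewrite /= normr_gt0.
by move=> y; rewrite -ball_normE /=; apply: contraTneq => ->; rewrite subr0 ltxx.
Qed.

Lemma derive_comp F (f : 'rV[R]_d -> 'rV[R]_d) x v :
  differentiable f x -> differentiable F (f x) ->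
  'D_v (F \o f) x = 'D_('D_v f x) F (f x).
Proof.
move=> df dF; have dFf : differentiable (F \o f) x by exact: differentiable_comp.
apply: etrans (deriveE v dFf) _; rewrite (diff_comp df dF).
apply: etrans (esym (deriveE _ dF)); rewrite /comp; congr ('d F (f x) _).
exact: esym (deriveE v df).
Qed.

(** Both sides differentiate [F (c *: y)] in [y] at [x], a neighbourhood of which avoids the origin.
    It serves [L] with [k = 1] and the gradient coordinates with [k = c^-1]. *)
Lemma derive_homogeneous F (c k : R) x v :
  (forall y, y != 0 -> F (c *: y) = k * F y) -> x != 0 ->
  differentiable F x -> differentiable F (c *: x) ->
  c * 'D_v F (c *: x) = k * 'D_v F x.
Proof.
move=> Fh x0 dFx dFcx.
pose f (y : 'rV[R]_d) := c *: y.
have [df fE] : is_diff x f f by exact: is_diff_scaler.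
have Df : 'D_v f x = f v by apply: etrans (deriveE v df) _; rewrite fE.
have -> : c * 'D_v F (c *: x) = 'D_v (F \o f) x.
  apply: etrans (esym (derive_comp F f x v df dFcx)); rewrite Df.
  by rewrite !derive_dot_grad // dotZr.
rewrite -[RHS]/(k *: _) -deriveZ; last exact: diff_derivable.
apply: near_eq_derive; near=> y; apply: Fh.
by near: y; exact: near_neq0.
Unshelve. all: by end_near. Qed.

End Calculus.

(** * Scale-invariant functions: homogeneity of derivatives, descent along lines, oscillation *)

Section ScaleInvariant.
Context {R : realType} {d : nat} (L : 'rV[R]_d -> R).
Context (LC2 : C2_off0 L) (Linv : scale_invariant L).
Implicit Types (x y u v : 'rV[R]_d).

Let dL x : x != 0 -> differentiable L x. Proof. exact: LC2.1. Qed.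

Let dgrad x i : x != 0 -> differentiable (fun y => grad L y 0 i) x.
Proof.
move=> x0; apply: (@differentiable_comp _ _ _ _ (grad L) (fun M : 'rV_d => M 0 i)).
  exact: LC2.2.1.
exact: differentiable_coord.
Qed.

Lemma grad_scale (c : R) x : 0 < c -> x != 0 ->
  grad L (c *: x) = c^-1 *: grad L x.
Proof.
move=> c0 x0; have c_neq0 := lt0r_neq0 c0; apply/rowP => i; rewrite !mxE.
have H := @derive_homogeneous _ _ L c 1 x (evec i).
apply: (mulfI c_neq0); rewrite mulVKf // H ?mul1r //.
- by move=> y y0; rewrite mul1r Linv.
- exact: dL.
- by apply: dL; rewrite scaler_eq0 negb_or c_neq0.
Qed.

Lemma hess_scale (c : R) x : 0 < c -> x != 0 ->
  hess L (c *: x) = c^-2 *: hess L x.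
Proof.
move=> c0 x0; have c_neq0 := lt0r_neq0 c0.
have cx0 : c *: x != 0 by rewrite scaler_eq0 negb_or c_neq0.
apply/matrixP => i j; rewrite [LHS]mxE [RHS]mxE [X in _ = _ * X]mxE.
apply: (mulfI c_neq0).
have gh y : y != 0 -> grad L (c *: y) 0 j = c^-1 * grad L y 0 j.
  by move=> y0; rewrite grad_scale // [LHS]mxE.
have dgx := dgrad x j x0; have dgcx := dgrad (c *: x) j cx0.
apply: etrans (derive_homogeneous _ c c^-1 x (evec i) gh x0 dgx dgcx) _.
by rewrite mulrA -[c ^- 2]exprVn expr2 mulrA divff // mul1r.
Qed.

(** Euler's identity: [L] is constant along the open ray through [x], so its derivative there at
    [s = 1] vanishes. *)
Lemma grad_orth x : dot (grad L x) x = 0.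
Proof.
have [->|x0] := eqVneq x 0; first by rewrite dot0r.
have [] : is_derive (1 : R) 1 (fun s => L (s *: x + 0 *: x))
    (dot (grad L (1 *: x + 0 *: x)) (1 *: x + 0 *: x)).
  apply: is_derive_curve; first by rewrite scale1r scale0r addr0; exact: dL.
  exact: (@is_derive_combination _ _ id (cst 0)).
rewrite scale1r scale0r addr0 => _ <-.
rewrite -(derive_cst (L x) (1 : R) 1); apply: near_eq_derive; near=> s.
rewrite addr0 Linv //.
by near: s; exact: lt_nbhsr.
Unshelve. all: by end_near. Qed.

Lemma is_derive_dot_grad (c : R -> 'rV[R]_d) (t : R) (c' v : 'rV[R]_d) :
  c t != 0 -> is_derive t 1 c c' ->
  is_derive t 1 (fun s => dot (grad L (c s)) v) (dot (c' *m hess L (c t)) v).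
Proof.
move=> ct0 dc.
have H i : is_derive t 1 (fun s => v 0 i * grad L (c s) 0 i)
    (v 0 i * (c' *m hess L (c t)) 0 i).
  have E : (c' *m hess L (c t)) 0 i = dot (grad (fun y => grad L y 0 i) (c t)) c'.
    by rewrite mxE; apply: eq_bigr => k _; rewrite !mxE mulrC.
  rewrite E; have dgi := dgrad (c t) i ct0.
  have G := @is_derive_curve _ _ (fun y => grad L y 0 i) c t c' dgi dc.
  exact: (@is_deriveZ _ _ _ (fun s => grad L (c s) 0 i)).
have := @is_derive_sum _ _ _ d _ _ _ _ H.
have -> : \sum_(i < d) v 0 i * (c' *m hess L (c t)) 0 i = dot (c' *m hess L (c t)) v.
  by apply: eq_bigr => i _; rewrite mulrC.
congr is_derive; apply/funext => s; rewrite fct_sumE.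
by apply: eq_bigr => i _; rewrite mulrC.
Qed.

Lemma normalize_invariant x : x != 0 -> L (normalize x) = L x.
Proof. by move=> x0; rewrite Linv // invr_gt0 norm2_gt0. Qed.

Context (rho : R) (Lrho : is_rho L rho) (rho_gt0 : 0 < rho).

(** The Hessian is homogeneous of degree -2, which carries the bound from the unit sphere to [x]. *)
Lemma hess_form_le x v : x != 0 ->
  dot x x * `|dot (v *m hess L x) v| <= rho * dot v v.
Proof.
move=> x0; have n0 := norm2_gt0 x x0.
have n1 : norm2 (normalize x) = 1 by rewrite norm2E dot_normalize ?sqrtr1.
have := quadratic_form_le (hess L (normalize x)) v rho rho_gt0 (Lrho.2 _ n1).
rewrite hess_scale ?invr_gt0 // -scalemxAr dotZl normrM.
by rewrite exprVn invrK norm2_sqr (ger0_norm (dot_ge0 x)).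
Qed.

Lemma line_descent x g s : x != 0 -> dot g x = 0 ->
  L (x - s *: g) <= L x - s * dot (grad L x) g
                  + rho * dot g g / dot x x / 2 * s ^+ 2.
Proof.
move=> x0 gx.
pose c (t : R) := 1 *: x + - t *: g.
have cE t : c t = x - t *: g by rewrite /c scale1r scaleNr.
have cc t : dot (c t) (c t) = dot x x + t ^+ 2 * dot g g.
  rewrite /c !(dotDl, dotDr, dotZl, dotZr) (dotC x g) gx; ring.
have c_ge t : dot x x <= dot (c t) (c t).
  by rewrite cc lerDl mulr_ge0 ?sqr_ge0 ?dot_ge0.
have xx := dot_gt0 x x0.
have c_neq0 t : c t != 0.
  by rewrite -dot_eq0 lt0r_neq0 // (lt_le_trans xx).
have dc (t : R) : is_derive t 1 c (- g).
  rewrite -[- g]add0r -[X in X + _](scale0r x) -scaleN1r.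
  exact: (@is_derive_combination _ _ (cst 1) (fun t => - t)).
have := @taylor2_le _ (fun t => L (c t)) (fun t => dot (grad L (c t)) (- g))
  (fun t => dot (- g *m hess L (c t)) (- g)) (rho * dot g g / dot x x) 0 s.
rewrite !cE scale0r !subr0 dotNr mulNr [_ * s]mulrC; apply.
- by move=> t; apply: is_derive_curve => //; exact: dL.
- by move=> t; apply: is_derive_dot_grad.
move=> t; rewrite ler_pdivlMr // mulrC.
have := hess_form_le (c t) (- g) (c_neq0 t).
have -> : dot (- g) (- g) = dot g g by rewrite dotNl dotNr opprK.
apply: le_trans; apply: le_trans (ler_wpM2l (ltW xx) (ler_norm _)) _.
by apply: ler_wpM2r.
Qed.

Lemma great_circle_le u e th : dot u u = 1 -> dot e e = 1 -> dot u e = 0 ->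
  0 <= th <= pi -> L u - L (cos th *: u + sin th *: e) <= rho * pi ^+ 2 / 4.
Proof.
move=> uu ee ue thpi.
pose c (t : R) := cos t *: u + sin t *: e.
pose c' (t : R) := - sin t *: u + cos t *: e.
have cc t : dot (c t) (c t) = 1.
  rewrite /c !(dotDl, dotDr, dotZl, dotZr) (dotC e u) uu ee ue; have := cos2Dsin2 t; lra.
have cc' t : dot (c' t) (c' t) = 1.
  rewrite /c' !(dotDl, dotDr, dotZl, dotZr) (dotC e u) uu ee ue; have := cos2Dsin2 t; lra.
have c_neq0 t : c t != 0 by rewrite -dot_eq0 cc oner_neq0.
have dc (t : R) : is_derive t 1 c (c' t) by exact: is_derive_combination.
pose f t := L (c t).
(* Split along the fixed vectors [u] and [e], since [is_derive_dot_grad] pairs the gradient with a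
   constant vector. *)
pose f' t := - sin t * dot (grad L (c t)) u + cos t * dot (grad L (c t)) e.
pose f'' t := dot (c' t *m hess L (c t)) (c' t).
have df (t : R) : is_derive t 1 f (f' t).
  have -> : f' t = dot (grad L (c t)) (c' t) by rewrite dotDr !dotZr.
  by apply: is_derive_curve => //; exact: dL.
have df' (t : R) : is_derive t 1 f' (f'' t).
  have du := is_derive_dot_grad c t (c' t) u (c_neq0 t) (dc t).
  have de := is_derive_dot_grad c t (c' t) e (c_neq0 t) (dc t).
  apply: is_derive_eq; rewrite /f'' /GRing.scale /=.
  (* Differentiating the cosine and sine factors contributes [- dot (grad L (c t)) (c t)], which
     vanishes; only the Hessian term is left. *)
  have := grad_orth (c t); rewrite {2}/c {4}/c' !(dotDr, dotZr).
  lra.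
have c_per t : c (t + pi *+ 2) = c t by rewrite /c cosD2pi sinD2pi.
have -> : rho * pi ^+ 2 / 4 = rho * (pi *+ 2) ^+ 2 / 16 by rewrite -mulr_natr; field.
have -> : L u = f 0 by rewrite /f /c cos0 sin0 scale1r scale0r addr0.
have p0 := pi_gt0 R.
apply: (@periodic_oscillation_le _ f f' f'').
- by rewrite mulr2n; lra.
- move=> t; have := hess_form_le (c t) (c' t) (c_neq0 t).
  by rewrite cc cc' mul1r mulr1.
- by move=> t; rewrite /f c_per.
- by move=> t; rewrite /f' c_per cosD2pi sinD2pi.
- by rewrite mulr2n; lra.
- by rewrite mulr2n; lra.
Qed.

(** [v] lies at angle [acos (dot u v)] on the great circle from [u] towards the component [w] of [v]
    orthogonal to [u]. If [w = 0], that direction is undetermined and [e0] supplies one. *)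
Lemma unit_oscillation_le u v e0 :
  dot u u = 1 -> dot v v = 1 -> dot e0 e0 = 1 -> dot u e0 = 0 ->
  L u - L v <= rho * pi ^+ 2 / 4.
Proof.
move=> uu vv e0e0 ue0.
pose al := dot u v; pose w := v - al *: u.
have uw : dot u w = 0 by rewrite /w dotDr dotNr dotZr uu mulr1 subrr.
have ww : dot w w = 1 - al ^+ 2.
  rewrite {1}/w dotDl dotNl dotZl uw mulr0 subr0 /w dotDr dotNr dotZr vv.
  by rewrite (dotC v) expr2.
have al1 : -1 <= al <= 1 by have := dot_ge0 w; rewrite ww => H; apply/andP; split; nra.
suff [e [ee ue vE]] : exists e,
    [/\ dot e e = 1, dot u e = 0 & v = al *: u + Num.sqrt (1 - al ^+ 2) *: e].
  have aE : cos (acos al) = al by apply: acosK; rewrite in_itv.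
  rewrite vE -sin_acos // -{1}aE.
  by apply: great_circle_le; rewrite // acos_ge0 //= acos_lepi.
have [w0|w0] := eqVneq w 0.
  exists e0; split=> //; rewrite -ww w0 dot0r sqrtr0 scale0r addr0.
  by apply/eqP; rewrite -subr_eq0 -/w w0.
exists (normalize w); split; first exact: dot_normalize.
  by rewrite dotZr uw mulr0.
rewrite -ww -norm2E scalerA divff ?lt0r_neq0 ?norm2_gt0 // scale1r.
by rewrite /w addrC subrK.
Qed.

(* The hypothesis [grad L x != 0] provides a direction orthogonal to [x], which
   is needed when [y] is a multiple of [x]. *)
Lemma oscillation_le x y : x != 0 -> y != 0 -> grad L x != 0 ->
  L x - L y <= rho * pi ^+ 2 / 4.
Proof.
move=> x0 y0 gx0; rewrite -(normalize_invariant x) // -(normalize_invariant y) //.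
apply: (@unit_oscillation_le _ _ (normalize (grad L x))); rewrite ?dot_normalize //.
by rewrite dotZl dotZr (dotC x) grad_orth !mulr0.
Qed.

End ScaleInvariant.

(** * One gradient step with weight decay, and bounds along the iterates *)

Section Descent.
Context {R : realType} {d : nat} (L : 'rV[R]_d -> R) (rho : R).
Context (LC2 : C2_off0 L) (Linv : scale_invariant L).
Context (Lrho : is_rho L rho) (rho_gt0 : 0 < rho).
Context (eta a : R).

Let step (x : 'rV[R]_d) := (1 - a) *: x - eta *: grad L x.

Lemma norm2_grad_normalize x : x != 0 ->
  norm2 (grad L (normalize x)) ^+ 2 = dot x x * dot (grad L x) (grad L x).
Proof.
move=> x0; rewrite grad_scale ?invr_gt0 ?norm2_gt0 // invrK norm2_sqr.
by rewrite dotZl dotZr mulrA -expr2 norm2_sqr.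
Qed.

Lemma dot_step x :
  dot (step x) (step x)
  = (1 - a) ^+ 2 * dot x x + eta ^+ 2 * dot (grad L x) (grad L x).
Proof.
rewrite /step !(dotDl, dotDr, dotNl, dotNr, dotZl, dotZr).
rewrite (dotC x (grad L x)) (grad_orth L LC2 Linv x); ring.
Qed.

(** Scale invariance absorbs the factor [1 - a], leaving a pure gradient step of length [s] between
    [eta] and [2 * eta]. As [rho * s / dot x x <= 1 / 2], the quadratic term uses up at most a
    quarter of the linear gain. *)
Lemma step_descent x : 0 < eta -> 0 < a -> a <= 2^-1 ->
  x != 0 -> 4 * (rho * eta) <= dot x x ->
  eta * dot (grad L x) (grad L x) <= 2 * (L x - L (step x)).
Proof.
move=> eta_gt0 a_gt0 a_le x0 xge; set g := grad L x; pose s := eta / (1 - a).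
have a1 : 0 < 1 - a by lra.
have sE : s * (1 - a) = eta by rewrite /s divfK // lt0r_neq0.
have ea : eta * a <= eta * 2^-1 by apply: ler_wpM2l => //; exact: ltW.
have ea0 : 0 < eta * a by exact: mulr_gt0.
have s_le : s <= 2 * eta by rewrite /s ler_pdivrMr //; lra.
have s_ge : eta <= s by rewrite /s ler_pdivlMr //; lra.
have stepE : step x = (1 - a) *: (x - s *: g).
  by rewrite /step scalerBr scalerA mulrC sE.
have gx : dot g x = 0 by exact: grad_orth.
have xx := dot_gt0 x x0.
have z0 : x - s *: g != 0.
  rewrite -dot_eq0 !(dotDl, dotDr, dotNl, dotNr, dotZl, dotZr) (dotC x g) gx.
  apply: lt0r_neq0; have := mulr_ge0 (sqr_ge0 s) (dot_ge0 g); lra.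
rewrite stepE Linv //.
have := line_descent L LC2 Linv rho Lrho rho_gt0 x g s x0 gx.
have -> : rho * dot g g / dot x x / 2 * s ^+ 2 = dot g g * s * (rho * s / dot x x) / 2.
  by field; exact: lt0r_neq0.
have : rho * s / dot x x <= 2^-1.
  by rewrite ler_pdivrMr //; have := ler_wpM2l (ltW rho_gt0) s_le; lra.
move: (rho * s / dot x x) => q q_le; rewrite -/g.
have G0 := dot_ge0 g.
have Gs : 0 <= dot g g * s by apply: mulr_ge0 => //; lra.
have : dot g g * s * q <= dot g g * s * 2^-1 by apply: ler_wpM2l.
have : dot g g * eta <= dot g g * s by apply: ler_wpM2l.
lra.
Qed.

(* If the gradient on the sphere is large, the squared norm cannot drop below
   the threshold [M] in one step. *)
Lemma dot_step_gt x (M : R) : 0 < a -> a <= 2^-1 -> 0 < M -> M <= dot x x ->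
  8 * a * M ^+ 2 < eta ^+ 2 * (dot x x * dot (grad L x) (grad L x)) ->
  M < dot (step x) (step x).
Proof.
move=> a_gt0 a_le M0; rewrite dot_step.
move: (dot x x) (dot (grad L x) (grad L x)) => y G yM bG.
have y0 : 0 < y by lra.
(* Multiplying by [y] brings in the product [y * G] bounded below by [bG]. *)
rewrite -(ltr_pM2l y0).
have -> : y * ((1 - a) ^+ 2 * y + eta ^+ 2 * G)
  = (1 - a) ^+ 2 * y ^+ 2 + eta ^+ 2 * (y * G) by ring.
suff : y * M <= (1 - a) ^+ 2 * y ^+ 2 + 8 * a * M ^+ 2 by lra.
have yy : 0 <= y ^+ 2 by exact: sqr_ge0.
have MM : 0 <= M ^+ 2 by exact: sqr_ge0.
(* For [a >= 1/8], [(1 - a)^2 >= 1/4] and [8 * a >= 1] reduce the claim to the square of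
   [y / 2 - M]. *)
case: (leP (8^-1) a) => a8.
  have h1 : 4^-1 * y ^+ 2 <= (1 - a) ^+ 2 * y ^+ 2 by apply: ler_wpM2r => //; nra.
  have h2 : M ^+ 2 <= 8 * a * M ^+ 2 by rewrite ler_peMl //; lra.
  have := sqr_ge0 (y / 2 - M); lra.
have h1 : (1 - 2 * a) * y ^+ 2 <= (1 - a) ^+ 2 * y ^+ 2.
  by apply: ler_wpM2r => //; nra.
suff : y * M <= (1 - 2 * a) * y ^+ 2 + 8 * a * M ^+ 2 by lra.
have yMM : 0 <= y * (y - M) by apply: mulr_ge0; lra.
(* The right side minus the left is [y * (y - M) + 2 * a * (4 * M^2 - y^2)], a sum of nonnegative
   terms up to [y = 2 * M]; beyond that, [4 * a < 1] suffices. *)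
case: (leP y (2 * M)) => y2.
  have : 0 <= 2 * a * ((2 * M - y) * (2 * M + y)).
    by rewrite !mulr_ge0 //; lra.
  lra.
have : 0 <= y * (y - 2 * M) by apply: mulr_ge0; lra.
have : 0 <= (1 - 4 * a) * y ^+ 2 by apply: mulr_ge0 => //; lra.
have : 0 <= a * M ^+ 2 by apply: mulr_ge0 => //; lra.
lra.
Qed.

(** By induction: the gradient term of [dot_step] is paid for by the decrease of [L], and the
    decreases telescope. The strict bound starts at [t = 1] because [x 0] may lie exactly on the
    threshold. *)
Lemma iterates_bound (x : nat -> 'rV[R]_d) (M : R) (T : nat) :
  0 < eta -> 0 < a -> a <= 2^-1 ->
  (forall t, x t.+1 = step (x t)) -> 0 < M -> 4 * (rho * eta) <= M ->
  M <= dot (x 0%N) (x 0%N) ->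
  (forall t, (t <= T)%N -> x t != 0 -> 8 * a * M ^+ 2 <
     eta ^+ 2 * (dot (x t) (x t) * dot (grad L (x t)) (grad L (x t)))) ->
  forall t, (t <= T)%N ->
  [/\ M <= dot (x t) (x t), (0 < t)%N -> M < dot (x t) (x t),
      L (x t) <= L (x 0%N) &
      dot (x t) (x t) <= (1 - a) ^+ (2 * t) * dot (x 0%N) (x 0%N)
                         + 2 * eta * (L (x 0%N) - L (x t))].
Proof.
move=> eta_gt0 a_gt0 a_le xS M0 Mge x0M big; elim=> [_|t IH tT].
  by split=> //; rewrite subrr mulr0 addr0 muln0 expr0 mul1r.
have [yM _ Lt yle] := IH (ltnW tT).
have xt0 : x t != 0 by rewrite -dot_eq0 lt0r_neq0 // (lt_le_trans M0).
have yS : M < dot (x t.+1) (x t.+1).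
  by rewrite xS; apply: dot_step_gt => //; apply: big => //; exact: ltnW.
have desc := step_descent (x t) eta_gt0 a_gt0 a_le xt0 (le_trans Mge yM).
have G0 := dot_ge0 (grad L (x t)).
split=> //; first exact: ltW.
  by rewrite xS; move: desc; have := mulr_ge0 (ltW eta_gt0) G0; lra.
rewrite {1 2}xS dot_step mulnS exprD xS.
move: desc yle; move: ((1 - a) ^+ (2 * t)) (dot (x t) (x t)) => E y desc yle.
have b0 : 0 <= (1 - a) ^+ 2 by exact: sqr_ge0.
have b1 : (1 - a) ^+ 2 <= 1 by nra.
have := ler_wpM2l b0 yle.
have LL : 0 <= 2 * eta * (L (x 0%N) - L (x t)) by rewrite !mulr_ge0 //; lra.
have := ler_wpM2r LL b1.
have := ler_wpM2l (ltW eta_gt0) desc.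
lra.
Qed.

End Descent.

(** * Length of the horizon and the final contradiction *)

Lemma contraction_le (R : realType) (a y M : R) (n : nat) :
  0 < a -> a <= 1 -> 0 < y -> 0 < M ->
  (2 * a)^-1 * ln (2 * y / M) <= n%:R -> (1 - a) ^+ (2 * n) * y <= M / 2.
Proof.
move=> a0 a1 y0 M0 nge.
have yM : 0 < 2 * y / M by rewrite divr_gt0 // mulr_gt0.
have lnle : ln (2 * y / M) <= a *+ (2 * n).
  rewrite -[a *+ _]mulr_natr natrM mulrA (mulrC a) -ler_pdivrMl //; lra.
(* From [1 - a <= expR (- a)]: the power is at most [expR (- 2 a n)], and the lower bound on [n]
   controls this exponential. *)
have : (1 - a) ^+ (2 * n) <= (2 * y / M)^-1.
  apply: le_trans (_ : expR (- (a *+ (2 * n))) <= _).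
    rewrite -mulNrn -mulr_natl expRM_natl lerXn2r ?nnegrE ?expR_ge0 //; first lra.
    exact: expR_ge1Dx.
  by rewrite expRN lef_pV2 ?posrE ?expR_gt0 // -[leLHS]lnK ?posrE // ler_expR.
move/(ler_wpM2r (ltW y0)) => /le_trans; apply.
suff -> : (2 * y / M)^-1 * y = M / 2 by [].
by field; rewrite !lt0r_neq0.
Qed.

Theorem mainTheorem12 (R : realType) (d : nat) (L : 'rV[R]_d -> R) (rho : R)
  (eta lambda : R) (x : nat -> 'rV[R]_d) :
  C2_off0 L -> scale_invariant L ->
  is_rho L rho -> 0 < rho ->
  0 < eta -> 0 < lambda -> eta * lambda <= 2^-1 ->
  pi ^+ 2 * rho * eta <= norm2 (x 0%N) ^+ 2 ->
  (forall t : nat, x t.+1 = (1 - eta * lambda) *: x t - eta *: grad L (x t)) ->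
  let T0 : nat := `|Num.ceil ((2 * eta * lambda)^-1 *
                    ln (2 * norm2 (x 0%N) ^+ 2 / (rho * pi ^+ 2 * eta)))|%N in
  exists2 t : nat, (t <= T0)%N &
    norm2 (grad L (normalize (x t))) ^+ 2 <= 8 * pi ^+ 4 * rho ^+ 2 * lambda * eta.
Proof.
move=> LC2 Linv Lrho rho0 eta0 lam0 a_le; rewrite norm2_sqr => x0M xS T0.
pose M := pi ^+ 2 * rho * eta; pose a := eta * lambda.
have a0 : 0 < a by exact: mulr_gt0.
have p0 := pi_gt0 R; have p2 := pi_ge2 R.
have re0 : 0 < rho * eta by exact: mulr_gt0.
have M0 : 0 < M by rewrite /M !mulr_gt0 // exprn_gt0.
(* Since [pi >= 2], the threshold [M] is large enough for [step_descent]. *)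
have M4 : 4 * (rho * eta) <= M.
  by rewrite /M -mulrA; apply: ler_wpM2r; [exact: ltW | nra].
have y0 : 0 < dot (x 0%N) (x 0%N) by exact: lt_le_trans x0M.
apply: contrapT => nex.
have big t : (t <= T0)%N -> x t != 0 -> 8 * a * M ^+ 2 <
    eta ^+ 2 * (dot (x t) (x t) * dot (grad L (x t)) (grad L (x t))).
  move=> tT xt0; rewrite -norm2_grad_normalize //.
  (* The target bound is exactly the gradient size that [dot_step_gt] asks for. *)
  have -> : 8 * a * M ^+ 2 = eta ^+ 2 * (8 * pi ^+ 4 * rho ^+ 2 * lambda * eta).
    by rewrite /a /M; ring.
  rewrite ltr_pM2l ?exprn_gt0 // ltNge; apply/negP => le_t; apply: nex.
  by exists t.
have T0E : (2 * a)^-1 * ln (2 * dot (x 0%N) (x 0%N) / M) <= T0%:R.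
  rewrite /T0 natr_absz /a /M mulrA (mulrC rho).
  apply: le_trans (ceil_ge _) _.
  by rewrite ler_int ler_norm.
clearbody T0.
(* The logarithm's argument is at least 2. A positive horizon is what makes the bound [M] strict at
   [T0]. *)
have T0_gt0 : (0 < T0)%N.
  rewrite -(ltr_nat R); apply: lt_le_trans T0E.
  rewrite mulr_gt0 ?invr_gt0 ?mulr_gt0 // ln_gt0 // ltr_pdivlMr //.
  by rewrite /M; lra.
have [yM /(_ T0_gt0) yM' _ yle] :=
  iterates_bound L rho LC2 Linv Lrho rho0 eta a x M T0
    eta0 a0 a_le xS M0 M4 x0M big T0 (leqnn _).
have nz t : M <= dot (x t) (x t) -> x t != 0.
  by move=> yt; rewrite -dot_eq0 lt0r_neq0 // (lt_le_trans M0).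
(* A zero gradient would contradict [big] at time 0. *)
have gx0 : grad L (x 0%N) != 0.
  apply: contraTneq (big 0%N (leq0n _) (nz _ x0M)) => ->.
  by rewrite dot0r !mulr0 -leNgt !mulr_ge0 ?sqr_ge0 // ltW.
have osc := oscillation_le L LC2 Linv rho Lrho rho0 (x 0%N) (x T0)
  (nz _ x0M) (nz _ yM) gx0.
have a1 : a <= 1 by rewrite /a; lra.
have contr := contraction_le R a _ M T0 a0 a1 y0 M0 T0E.
have := ler_wpM2l (ltW eta0) osc.
move: yM' yle contr; rewrite /M; lra.
Qed.
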